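(* Suppose $(\Omega,\mathcal{F},\mathsf{P})$ is atomless and $u$ is a law invariant coherent utility on $L^0$ with determining set $\mathcal{D}$. Then for any random variable $X$ and any random vectors $Y,Y'$, $$u^f(X;Y,Y')\le u^f(X;Y),$$ where $u^f(X;Y,Y')$ denotes the factor utility with respect to the compound random vector $(Y,Y')$.
   Context: Let $(\Omega,\mathcal{F},\mathsf{P})$ be a probability space, $L^0$ the space of all real random variables, and $\mathcal{P}$ the set of probability measures on $\mathcal{F}$ absolutely continuous with respect to $\mathsf{P}$; measures $\mathsf{Q}\in\mathcal{P}$ are identified with their densities. For $\mathsf{Q}\in\mathcal{P}$ and $X\in L^0$, $\mathsf{E}_\mathsf{Q}X:=\mathsf{E}_\mathsf{Q}X^+-\mathsf{E}_\mathsf{Q}X^-$ with the convention $\infty-\infty=-\infty$. A coherent utility on $L^0$ is a map $u:L^0\to[-\infty,\infty]$ of the form $u(X)=\inf_{\mathsf{Q}\in\mathcal{D}}\mathsf{E}_\mathsf{Q}X$ for a nonempty $\mathcal{D}\subseteq\mathcal{P}$; its determining set is the largest such set, $\{\mathsf{Q}\in\mathcal{P}:\mathsf{E}_\mathsf{Q}X\ge u(X)\ \forall X\in L^0\}$. $u$ is law invariant if $u(X)=u(X')$ whenever $X,X'$ have the same distribution. For a random vector $Y$, $\mathsf{E}(\mathcal{D}\mid Y):=\{\mathsf{E}(Z\mid Y):Z\in\mathcal{D}\}$ and the factor utility is $u^f(X;Y):=\inf_{\mathsf{Q}\in\mathsf{E}(\mathcal{D}\mid Y)}\mathsf{E}_\mathsf{Q}X$.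 *)

(* Defs.v *)
From HB Require Import structures.
From mathcomp Require Import all_boot all_order all_algebra.
From mathcomp Require Import all_classical all_reals all_analysis.
Set Implicit Arguments. Unset Strict Implicit. Unset Printing Implicit Defensive.
Import Order.TTheory GRing.Theory Num.Theory.
Local Open Scope classical_set_scope.
Local Open Scope ring_scope.
Local Open Scope ereal_scope.

Section defs.
Context {d : measure_display} {T : measurableType d} {R : realType}.
Variable P : probability T R.

Definition atomless : Prop :=
  forall A : set T, measurable A -> (0 < P A)%E ->
    exists B : set T, [/\ measurable B, B `<=` A, (0 < P B)%E & (P B < P A)%E].

Definition rv (X : T -> R) : Prop := measurable_fun setT X.

(* Elements of the set \mathcal{P}, identified with their densities dQ/dP *)
Definition density (Z : T -> R) : Prop :=
  [/\ measurable_fun setT Z, (forall x, 0 <= Z x)%R & \int[P]_x (Z x)%:E = 1].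

(* E_Q X := E_Q X^+ - E_Q X^-, with the convention oo - oo = -oo;
   Q is given by its density Z w.r.t. P *)
Definition expQ (Z : T -> R) (X : T -> R) : \bar R :=
  let a := \int[P]_x (Z x * Num.max (X x) 0%R)%:E in
  let b := \int[P]_x (Z x * Num.max (- X x) 0%R)%:E in
  if b == +oo then -oo else a - b.

Definition inf_util (D : set (T -> R)) (X : T -> R) : \bar R :=
  ereal_inf [set expQ Z X | Z in D].

Definition coherent_utility (u : (T -> R) -> \bar R) : Prop :=
  exists D : set (T -> R), [/\ D !=set0, D `<=` density &
    forall X, rv X -> u X = inf_util D X].

Definition determining_set (u : (T -> R) -> \bar R) : set (T -> R) :=
  [set Z | density Z /\ forall X, rv X -> (u X <= expQ Z X)%E].

Definition same_law (X X' : T -> R) : Prop :=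
  forall B : set R, measurable B -> P (X @^-1` B) = P (X' @^-1` B).

Definition law_invariant (u : (T -> R) -> \bar R) : Prop :=
  forall X X', rv X -> rv X' -> same_law X X' -> u X = u X'.

Definition rvec n (Y : 'I_n -> T -> R) : Prop := forall i, rv (Y i).

Definition vcat n m (Y : 'I_n -> T -> R) (Y' : 'I_m -> T -> R) :
    'I_(n + m) -> T -> R :=
  fun k => match fintype.split k with inl i => Y i | inr j => Y' j end.

Definition sigmaY n (Y : 'I_n -> T -> R) : set (set T) :=
  <<s [set A | exists i B, measurable B /\ A = Y i @^-1` B] >>.

Definition is_condexp (G : set (set T)) (Z W : T -> R) : Prop :=
  [/\ forall B : set R, measurable B -> G (W @^-1` B),
      P.-integrable setT (EFin \o W) &
      forall A, G A -> \int[P]_(x in A) (W x)%:E = \int[P]_(x in A) (Z x)%:E].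

Definition condexp_set (D : set (T -> R)) n (Y : 'I_n -> T -> R) : set (T -> R) :=
  [set W | exists2 Z, D Z & is_condexp (sigmaY Y) Z W].

Definition factor_utility (D : set (T -> R)) n (Y : 'I_n -> T -> R) (X : T -> R)
  : \bar R := inf_util (condexp_set D Y) X.

End defs.

(* Main.v *)
(**
  The determining set [D] is stable under conditioning: if [Z] is in [D] and
  [V = E(Z | Y)], then [V] is in [D].  Given this, [V] is its own conditional
  expectation with respect to [(Y, Y')], so [E(D | Y)] is contained in
  [E(D | Y, Y')] up to null sets, and the infimum over the latter is smaller.

  For the stability one has to show [u X <= E_V X].  Round [X] up to a multiple
  of a small [e]; it is then a function of two vanishing chains of sets,
  [{X > e n}] and [{X <= - e (n + 1)}].  As [P] is atomless, the first chain can
  be replaced by a chain of sets of the same probabilities on which [Z] is as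
  small as possible, and the second by one on which [Z] is as large as possible.
  This yields a variable [F'] with the law of the rounding of [X], so that
  [u X <= u F' <= E_Z F'].  A conditional Jensen inequality for [t - Z]
  compares the integral of [Z] over each new set with the integral of [V] over
  the old one, and summing over the chains gives [E_Z F' <= E_V X + 2 e].
  Positive and negative parts are compared separately, which covers infinite
  expectations.
*)
Require Import Defs.
From HB Require Import structures.
From mathcomp Require Import all_boot all_order all_algebra.
From mathcomp Require Import all_classical all_reals all_analysis.
From mathcomp Require Import measurable_realfun lra.
Import Order.TTheory GRing.Theory Num.Theory.
Import numFieldNormedType.Exports.
Local Open Scope classical_set_scope.
Local Open Scope ring_scope.
Local Open Scope ereal_scope.

Set Implicit Arguments.
Unset Strict Implicit.

(** * Subsets of prescribed probability in an atomless space *)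

Section atomless_sets.
Context d (T : measurableType d) (R : realType) (P : probability T R).
Implicit Types (A B C E : set T) (p e : R).

Let pr A : R := fine (P A).

Let prE A : measurable A -> P A = (pr A)%:E.
Proof. by move=> mA; rewrite fineK// fin_num_measure. Qed.

Let pr_ge0 A : (0 <= pr A)%R.
Proof. exact: fine_ge0. Qed.

Let pr_le A B : measurable A -> measurable B -> A `<=` B -> (pr A <= pr B)%R.
Proof.
by move=> mA mB AB; rewrite -lee_fin -!prE//; apply: le_measure => //; rewrite inE.
Qed.

Let prU A B : measurable A -> measurable B -> A `&` B = set0 ->
  pr (A `|` B) = (pr A + pr B)%R.
Proof.
move=> mA mB AB; apply: EFin_inj; rewrite -prE; last exact: measurableU.
by rewrite EFinD -!prE// measureU.
Qed.

Let prD A B : measurable A -> measurable B -> B `<=` A ->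
  pr (A `\` B) = (pr A - pr B)%R.
Proof.
move=> mA mB BA; rewrite -[in pr A](setDUK BA) prU//.
- by rewrite addrAC subrr add0r.
- exact: measurableD.
- by rewrite setDIK.
Qed.

Let pr_bigcup_le (F : (set T)^nat) p : (forall n, measurable (F n)) ->
  {homo F : n m / (n <= m)%N >-> n `<=` m} -> (forall n, pr (F n) <= p)%R ->
  (pr (\bigcup_n F n) <= p)%R.
Proof.
move=> mF ndF Fp; rewrite -lee_fin -prE; last exact: bigcup_measurable.
have /cvg_lim <- // := @nondecreasing_cvg_mu _ _ _ P F mF
  (bigcup_measurable (fun k _ => mF k))
  (fun n m nm => introT (subsetPset _ _) (ndF n m nm)).
apply: lime_le.
  apply/cvg_ex; eexists; apply: nondecreasing_cvg_mu => //.
    exact: bigcup_measurable.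
  by move=> n m nm; apply/subsetPset; exact: ndF.
by apply: nearW => n /=; rewrite prE ?lee_fin.
Qed.

Let pr_bigcap_ge (F : (set T)^nat) p : (forall n, measurable (F n)) ->
  {homo F : n m / (n <= m)%N >-> m `<=` n} -> (forall n, p <= pr (F n))%R ->
  (p <= pr (\bigcap_n F n))%R.
Proof.
move=> mF niF Fp; rewrite -lee_fin -prE; last exact: bigcapT_measurable.
have cF : P (F n) @[n --> \oo] --> P (\bigcap_n F n).
  apply: nonincreasing_cvg_mu => //.
  - exact: (le_lt_trans (probability_le1 P (mF 0%N)) (ltry _)).
  - exact: bigcapT_measurable.
  - by move=> n m nm; apply/subsetPset; exact: niF.
have /cvg_lim <- // := cF.
apply: lime_ge; first by apply/cvg_ex; eexists; exact: cF.
by apply: nearW => n /=; rewrite prE ?lee_fin.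
Qed.

Hypothesis Patomless : atomless P.

(** Halving: atomlessness splits a set of positive probability into two parts of positive
    probability, one of which carries at most half of it. *)
Lemma atomless_small_subset A e : measurable A -> 0 < P A -> (0 < e)%R ->
  exists E, [/\ measurable E, E `<=` A, 0 < P E & P E <= e%:E].
Proof.
move=> mA PA e0.
have half n : exists E, [/\ measurable E, E `<=` A, 0 < P E &
    (pr E * 2 ^+ n <= pr A)%R].
  elim: n => [|n [E [mE EA PE En]]]; first by exists A; split; rewrite ?expr0 ?mulr1.
  have [B [mB BE PB BlE]] := Patomless mE PE.
  move: PB BlE; rewrite !prE// !lte_fin => PB BlE.
  have prEB := prD mE mB BE.
  have [BB|BB] := lerP (pr B * 2) (pr E).
    exists B; split; rewrite ?prE ?lte_fin//; first exact: subset_trans EA.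
    by rewrite exprS mulrA (le_trans _ En)// ler_wpM2r// exprn_ge0.
  exists (E `\` B); split.
  - exact: measurableD.
  - exact: subset_trans (@subDsetl _ _ _) EA.
  - by rewrite prE ?lte_fin ?prEB ?subr_gt0//; exact: measurableD.
  - rewrite exprS mulrA (le_trans _ En)// ler_wpM2r// ?exprn_ge0// prEB; lra.
have [n ne] : exists n, (1 <= e * n%:R)%R.
  exists (Num.truncn e^-1).+1; rewrite mulrC -ler_pdivrMr// div1r.
  by rewrite ltW// truncnS_gt.
have [E [mE EA PE En]] := half n; exists E; split=> //.
rewrite prE// lee_fin.
have PA1 : (pr A <= 1)%R by rewrite -lee_fin -prE// probability_le1.
have nn : (n%:R <= 2 ^+ n :> R)%R by rewrite -natrX ler_nat ltnW// ltn_expl.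
have n0 : (0 < n%:R :> R)%R.
  by case: n ne {En nn} => [|n]; rewrite ?mulr0 ?ler10// ltr0n.
rewrite -(ler_pM2r n0) (le_trans _ ne)// (le_trans _ PA1)// (le_trans _ En)//.
exact: ler_wpM2l.
Qed.

(* Greedy exhaustion: each step fills at least half of what can still be
   added, so a defect below [p] would allow infinitely many increments of a
   fixed positive size. *)
Lemma atomless_subset_measure A p : measurable A -> (0 <= p)%R -> p%:E <= P A ->
  exists E, [/\ measurable E, E `<=` A & P E = p%:E].
Proof.
move=> mA p0 pA.
pose ok B := [/\ measurable B, B `<=` A & (pr B <= p)%R].
pose step (B B' : {B | ok B}) := sval B `<=` sval B' /\
  forall E, ok E -> sval B `<=` E ->
    (pr E - pr (sval B) <= 2 * (pr (sval B') - pr (sval B)))%R.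
have next (s : {B | ok B}) : {s' | step s s'}.
  apply: cid; case: s => B okB; rewrite /step/=.
  pose S := [set pr E | E in [set E | ok E /\ B `<=` E]].
  have SB : S (pr B) by exists B => //; split.
  have hS : has_sup S.
    by split; [exists (pr B)|exists p => _ [E [[_ _ ?] _] <-]].
  have SB_le : (pr B <= sup S)%R by exact: ub_le_sup hS.2 _ SB.
  have [BS|SB'] := ltrP (pr B) (sup S); last first.
    exists (exist _ B okB) => /=; split=> // E okE BE.
    have : (pr E <= sup S)%R by apply: ub_le_sup hS.2 _ _; exists E.
    move: SB'; lra.
  (* A candidate above the midpoint of [pr B] and [sup S] realises at least half of the possible
     gain. *)
  have [_ [E [okE BE] <-] SE] := @sup_adherent _ S ((sup S - pr B) / 2)%R
    ltac:(move: BS; lra) hS.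
  exists (exist _ E okE) => /=; split=> // E' okE' BE'.
  have : (pr E' <= sup S)%R by apply: ub_le_sup hS.2 _ _; exists E'.
  move: SE; lra.
have ok0 : ok set0 by split=> //; rewrite /pr measure0.
have [f [f0 fS]] := dependent_choice next (exist _ set0 ok0).
pose F n := sval (f n).
have okF n : ok (F n) by exact: svalP (f n).
have mF n : measurable (F n) by have [] := okF n.
have ndF : {homo F : n m / (n <= m)%N >-> n `<=` m}.
  apply: (@homo_leq _ F (@subset T)) => [A'//|A1 A2 A3|n]; first exact: subset_trans.
  by have [] := fS n.
have mU : measurable (\bigcup_n F n) by exact: bigcup_measurable.
have UA : \bigcup_n F n `<=` A by apply: bigcup_sub => n _; have [] := okF n.
have Up : (pr (\bigcup_n F n) <= p)%R.
  by apply: pr_bigcup_le => // n; have [] := okF n.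
exists (\bigcup_n F n); split=> //; rewrite prE//; congr EFin.
apply/eqP; rewrite eq_le Up/= leNgt; apply/negP => Ultp.
have mAU : measurable (A `\` \bigcup_n F n) by exact: measurableD.
(* [E] misses every [F n] and is no larger than the defect, so adding it to [F n] is admissible at
   every step; hence every increment is at least [pr E / 2]. *)
have [E [mE EAU]] := @atomless_small_subset (A `\` \bigcup_n F n)
  (p - pr (\bigcup_n F n))%R mAU
  ltac:(rewrite prE// lte_fin prD//; move: pA; rewrite prE// lee_fin; lra)
  ltac:(lra).
rewrite prE// lte_fin lee_fin => E0 Ele.
have FE n : F n `&` E = set0.
  by rewrite -subset0 => x [Fx /EAU[_]]; apply; exists n.
have incr n : (pr E <= 2 * (pr (F n.+1) - pr (F n)))%R.
  have [_ /(_ (F n `|` E))] := fS n; rewrite -/(F n) -/(F n.+1) prU//.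
  have -> : (pr (F n) + pr E - pr (F n) = pr E)%R by lra.
  apply=> //; split.
  - exact: measurableU.
  - by rewrite subUset; split; [have [] := okF n|move=> x /EAU[]].
  - rewrite prU//.
    have : (pr (F n) <= pr (\bigcup_n F n))%R by apply: pr_le => // x ?; exists n.
    move: Ele; lra.
have many n : (n%:R * pr E <= 2 * pr (F n))%R.
  elim: n => [|n IH]; first by rewrite mul0r mulr_ge0.
  move: IH (incr n); rewrite -natr1; lra.
have := many (Num.truncn (2 * p / pr E)).+1; apply/negP; rewrite -ltNge.
apply: (@le_lt_trans _ _ (2 * p)%R).
  by rewrite ler_pM2l//; have [] := okF (Num.truncn (2 * p / pr E)).+1.
by rewrite -ltr_pdivrMr// truncnS_gt.
Qed.

(** Apart from the empty set and the whole space, these are the sets between [{Z < t}] and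
    [{Z <= t}] for some [t]. The level [Z = t] may be cut arbitrarily, which leaves room to
    prescribe the probability. *)
Definition lower_set_of (Z : T -> R) C := forall x y, C x -> ~ C y -> (Z x <= Z y)%R.

(** Quantile argument: take the part of [B] strictly below the [p]-quantile [t0] of [Z] on [B], and
    complete it by a piece of the level [Z = t0]. *)
Lemma lower_subset_measure (Z : T -> R) B p : measurable_fun setT Z ->
  measurable B -> lower_set_of Z B -> (0 <= p)%R -> p%:E <= P B ->
  exists C, [/\ measurable C, C `<=` B, lower_set_of Z C & P C = p%:E].
Proof.
move=> mZ mB lB p0; rewrite prE// lee_fin => pB.
(* For [p] equal to [0] or [pr B] the quantile could be infinite; the strict inequalities make [S]
   below nonempty and bounded from below. *)
have [->|pn0] := eqVneq p 0%R.
  by exists set0; split=> //; rewrite measure0.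
have [pB'|pBn] := eqVneq p (pr B).
  by exists B; split=> //; rewrite prE// pB'.
have {p0 pn0}p0 : (0 < p)%R by rewrite lt_neqAle eq_sym pn0.
have {pB pBn}pB : (p < pr B)%R by rewrite lt_neqAle pBn.
pose L t := B `&` [set x | (Z x <= t)%R].
have mL t : measurable (L t).
  apply: measurableI => //; rewrite -[X in measurable X]setTI.
  by rewrite -preimage_itvNyc; exact: mZ.
have LS s t : (s <= t)%R -> L s `<=` L t.
  by move=> st x [Bx Zx]; split=> //=; exact: le_trans Zx st.
pose S := [set t | (p <= pr (L t))%R].
have S0 : S !=set0.
  apply: contrapT => S0; suff : (pr B <= p)%R by rewrite leNgt pB.
  have -> : B = \bigcup_n L n%:R.
    apply/seteqP; split=> [x Bx|x [n _ []]//].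
    by exists (Num.truncn (Z x)).+1 => //; split=> //=; rewrite ltW// truncnS_gt.
  apply: pr_bigcup_le => // [n m nm|n]; first by apply: LS; rewrite ler_nat.
  by rewrite leNgt; apply/negP => /ltW pL; apply: S0; exists n%:R.
have lbS : has_lbound S.
  apply: contrapT => nlb; suff : (p <= pr set0)%R.
    by rewrite /pr measure0/= leNgt p0.
  have -> : set0 = \bigcap_n L (- n%:R)%R.
    apply/seteqP; split=> // x /(_ (Num.truncn (- Z x)).+1 I)[_ /=].
    by rewrite lerNr leNgt truncnS_gt.
  apply: pr_bigcap_ge => // [n m nm|n]; first by apply: LS; rewrite lerN2 ler_nat.
  rewrite leNgt; apply/negP => pL; apply: nlb; exists (- n%:R)%R => t St.
  rewrite leNgt; apply/negP => tn.
  by move: St; rewrite /S/= leNgt (le_lt_trans _ pL)// pr_le//; apply: LS; exact: ltW.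
have infS : has_inf S by [].
pose t0 := inf S.
have St t : (t0 < t)%R -> (p <= pr (L t))%R.
  move=> t0t; have [s Ss st] := @inf_adherent _ S (t - t0)%R
    ltac:(by rewrite subr_gt0) infS.
  apply: le_trans Ss _; apply: pr_le => //; apply: LS.
  by move: st; rewrite /t0 subrKC => /ltW.
have nSt t : (t < t0)%R -> (pr (L t) <= p)%R.
  move=> tt0; rewrite leNgt; apply/negP => /ltW pL.
  by move: tt0; rewrite ltNge; apply/negP; rewrite negbK; exact: ge_inf.
have inv0 n : (0 < n.+1%:R^-1 :> R)%R by rewrite invr_gt0.
have small e : (0 < e)%R -> exists n, (n.+1%:R^-1 < e)%R.
  move=> e0; exists (Num.truncn e^-1); rewrite invf_plt ?posrE//.
  exact: truncnS_gt.
(* The infimum is attained, by continuity from above along [t0 + 1/(n+1)]. *)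
have pL0 : (p <= pr (L t0))%R.
  have -> : L t0 = \bigcap_n L (t0 + n.+1%:R^-1)%R.
    apply/seteqP; split=> [x [Bx Zx] n _|x Lx].
      by split=> //=; rewrite (le_trans Zx)// lerDl ltW.
    split; first by have [] := Lx 0%N I.
    rewrite /= leNgt; apply/negP => Zx.
    have [n] := small (Z x - t0)%R ltac:(by rewrite subr_gt0).
    by have [_ /=] := Lx n I; rewrite ltrBrDl leNgt => /negP.
  apply: pr_bigcap_ge => // [n m nm|n].
    by apply: LS; rewrite lerD2l lef_pV2 ?posrE ?ltr0n// ler_nat.
  by apply: St; rewrite ltrDl.
(* [K] is the part of [B] where [Z < t0], written as an increasing union so that continuity from
   below bounds it by [p]. *)
pose K := \bigcup_n L (t0 - n.+1%:R^-1)%R.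
have mK : measurable K by exact: bigcup_measurable.
have KP x : K x <-> B x /\ (Z x < t0)%R.
  split=> [[n _ [Bx /= Zx]]|[Bx Zx]].
    by split=> //; rewrite (le_lt_trans Zx)// ltrBlDr ltrDl.
  have [n ?] := small (t0 - Z x)%R ltac:(by rewrite subr_gt0).
  by exists n => //; split=> //=; rewrite lerBrDr -lerBrDl ltW.
have pK : (pr K <= p)%R.
  apply: pr_bigcup_le => // [n m nm|n].
    by apply: LS; rewrite lerD2l lerN2 lef_pV2 ?posrE ?ltr0n// ler_nat.
  by apply: nSt; rewrite ltrBlDr ltrDl.
have KL : K `<=` L t0 by move=> x /KP[Bx /ltW].
have mLK : measurable (L t0 `\` K) by exact: measurableD.
have [E [mE ELK PE]] := @atomless_subset_measure (L t0 `\` K) (p - pr K)%R mLK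
  ltac:(by rewrite subr_ge0)
  ltac:(by rewrite prE// lee_fin prD// lerD2r).
have KE : K `&` E = set0 by rewrite -subset0 => x [Kx /ELK[]].
have CL x : (K `|` E) x -> B x /\ (Z x <= t0)%R.
  by case=> [/KL[]//|/ELK[[]]].
exists (K `|` E); split.
- exact: measurableU.
- by move=> x /CL[].
- move=> x y /CL[Bx Zx] nCy; have [By|nBy] := pselect (B y); last exact: lB.
  apply: (le_trans Zx); rewrite leNgt; apply/negP => Zy; apply: nCy.
  by left; apply/KP.
- rewrite prE; last exact: measurableU.
  rewrite prU//; move: PE; rewrite prE// => -[->]; by rewrite subrKC.
Qed.

(** Being a lower set refers to the whole space and not to [B], so each set produced can play the
    role of [B] in the next step. *)
Lemma lower_chain_measure (Z : T -> R) B (p : R^nat) : measurable_fun setT Z ->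
  measurable B -> lower_set_of Z B -> (forall n, 0 <= p n)%R ->
  (forall n, p n.+1 <= p n)%R -> (p 0%N)%:E <= P B ->
  exists C : (set T)^nat, [/\ forall n, measurable (C n), C 0%N `<=` B,
    forall n, C n.+1 `<=` C n, forall n, lower_set_of Z (C n) &
    forall n, P (C n) = (p n)%:E].
Proof.
move=> mZ mB lB p0 pS pB.
(* The index travels with the set, since the probability required of the next set depends on it. *)
pose ok (x : nat * set T) :=
  [/\ measurable x.2, lower_set_of Z x.2 & P x.2 = (p x.1)%:E].
pose step (x y : {x | ok x}) :=
  (sval y).1 = (sval x).1.+1 /\ (sval y).2 `<=` (sval x).2.
have next (x : {x | ok x}) : {y | step x y}.
  apply: cid; case: x => -[n C] okC; have [/= mC lC PC] := okC.
  have [C' [mC' C'C lC' PC']] := @lower_subset_measure Z C (p n.+1) mZ mC lC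
    (p0 _) ltac:(by rewrite PC lee_fin).
  by exists (exist _ (n.+1, C') (And3 mC' lC' PC')).
have [C0 [mC0 C0B lC0 PC0]] := lower_subset_measure mZ mB lB (p0 0%N) pB.
have [f [f0 fS]] := dependent_choice next
  (exist _ (0%N, C0) (And3 mC0 lC0 PC0)).
have f1 n : (sval (f n)).1 = n.
  by elim: n => [|n IH]; [rewrite f0|have [-> _] := fS n; rewrite IH].
exists (fun n => (sval (f n)).2); split=> [n||n|n|n].
- by have [] := svalP (f n).
- by rewrite f0.
- by have [] := fS n.
- by have [] := svalP (f n).
- by have [_ _] := svalP (f n); rewrite f1.
Qed.

End atomless_sets.

(** * Comparison of integrals of a variable and of its conditional expectation *)

Section lower_set_integral.
Context d (T : measurableType d) (R : realType) (P : probability T R).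
Implicit Types (A C : set T) (f Z W : T -> R).

Lemma EFin_Rintegral f A : P.-integrable setT (EFin \o f) -> measurable A ->
  \int[P]_(x in A) (f x)%:E = (\int[P]_(x in A) f x)%R%:E.
Proof.
move=> intf mA; rewrite /Rintegral fineK//.
by apply: integrable_fin_num => //; exact: integrableS intf.
Qed.

(** The extensions by zero of [f] from [A] and from [C] already compare pointwise. *)
Lemma Rintegral_le_sets f A C : P.-integrable setT (EFin \o f) ->
  measurable A -> measurable C ->
  (forall x, A x -> ~ C x -> f x <= 0)%R -> (forall x, C x -> ~ A x -> 0 <= f x)%R ->
  (\int[P]_(x in A) f x <= \int[P]_(x in C) f x)%R.
Proof.
move=> intf mA mC fA fC; rewrite Rintegral_mkcond [leRHS]Rintegral_mkcond.
have intr B : measurable B -> P.-integrable setT (EFin \o (f \_ B)).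
  move=> mB; rewrite -restrict_EFin; apply/integrable_restrict => //.
  by rewrite setTI; exact: integrableS intf.
apply: le_Rintegral => //; [exact: intr|exact: intr|move=> x _].
rewrite /patch; case: ifPn => xA; case: ifPn => xC //.
- by apply: fA; [exact/set_mem|move: xC; rewrite notin_setE].
- by apply: fC; [exact/set_mem|move: xA; rewrite notin_setE].
Qed.

(* With a threshold [t] separating [Z] on [C] from [Z] off [C],
   [int_A (t - W) <= int_{W < t} (t - W) = int_{W < t} (t - Z) <= int_C (t - Z)]. *)
Lemma lower_set_integral_le Z W A C :
  P.-integrable setT (EFin \o Z) -> P.-integrable setT (EFin \o W) ->
  (forall S, measurable S ->
    \int[P]_(x in W @^-1` S) (W x)%:E = \int[P]_(x in W @^-1` S) (Z x)%:E) ->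
  measurable A -> measurable C -> lower_set_of Z C -> P C = P A ->
  \int[P]_(x in C) (Z x)%:E <= \int[P]_(x in A) (W x)%:E.
Proof.
move=> intZ intW WZ mA mC lC PCA.
have mW : measurable_fun setT W by apply/measurable_EFinP; exact: measurable_int intW.
have mWS S : measurable S -> measurable (W @^-1` S).
  by move=> mS; rewrite -[X in measurable X]setTI; exact: mW.
(* A finite threshold requires points in [C] and off [C]. If one kind is missing, [A] has
   probability [0] or [1] and the two integrals are equal. *)
have [C0|/set0P[x0 Cx0]] := eqVneq C set0.
  have PA : P A = 0 by rewrite -PCA C0 measure0.
  rewrite C0 integral_set0 (@null_set_integral _ _ _ P A)//.
  by apply: (@measurable_int _ _ _ P); exact: integrableS intW.
have [C1|/set0P[y0 Cy0]] := eqVneq (~` C) set0.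
  have PA : P (~` A) = 0.
    rewrite probability_setC// -PCA -(setCK C) C1 setC0 probability_setT subee//.
  have -> : \int[P]_(x in A) (W x)%:E = \int[P]_x (W x)%:E.
    rewrite [RHS](@negligible_integral _ _ _ P _ (~` A))//.
    - by rewrite setTD setCK.
    - exact: measurableC.
  by have := WZ setT measurableT; rewrite preimage_setT -(setCK C) C1 setC0 => ->.
pose t := sup (Z @` C).
have hs : has_sup (Z @` C).
  split; first by exists (Z x0), x0.
  by exists (Z y0) => _ [x Cx <-]; exact: lC.
have Zt x : C x -> (Z x <= t)%R.
  by move=> Cx; apply: ub_le_sup; [exact: hs.2|exists x].
have tZ y : ~ C y -> (t <= Z y)%R.
  by move=> Cy; apply: ge_sup; [exact: hs.1|move=> _ [x Cx <-]; exact: lC].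
have intt : P.-integrable setT (EFin \o cst t).
  exact: finite_measure_integrable_cst.
have intB f : P.-integrable setT (EFin \o f) ->
    P.-integrable setT (EFin \o (fun x => t - f x)%R).
  by move=> intf; rewrite (_ : _ \o _ = (EFin \o cst t) \- (EFin \o f))//;
    exact: integrableB.
have RB f B : P.-integrable setT (EFin \o f) -> measurable B ->
    (\int[P]_(x in B) (t - f x) = t * fine (P B) - \int[P]_(x in B) f x)%R.
  move=> intf mB; rewrite RintegralB//; [|exact: integrableS intt|exact: integrableS intf].
  by rewrite Rintegral_cst.
pose G := W @^-1` `]-oo, t[.
have mG : measurable G by exact: mWS.
have GP x : G x = (W x < t)%R :> Prop by rewrite /G/= in_itv.
have WG : (\int[P]_(x in G) W x = \int[P]_(x in G) Z x)%R.
  by apply: EFin_inj; rewrite -!EFin_Rintegral//; apply: WZ; exact: measurable_itv.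
rewrite !EFin_Rintegral// lee_fin.
have h1 : (\int[P]_(x in A) (t - W x) <= \int[P]_(x in G) (t - W x))%R.
  apply: Rintegral_le_sets => //; first exact: intB.
  - by move=> x _; rewrite GP => /negP; rewrite -leNgt subr_le0.
  - by move=> x; rewrite GP => /ltW; rewrite subr_ge0.
have h2 : (\int[P]_(x in G) (t - Z x) <= \int[P]_(x in C) (t - Z x))%R.
  apply: Rintegral_le_sets => //; first exact: intB.
  - by move=> x _ /tZ; rewrite subr_le0.
  - by move=> x /Zt; rewrite subr_ge0.
move: h1 h2; rewrite !RB// PCA WG; lra.
Qed.

End lower_set_integral.

(** * Layer representation of integer-valued variables by decreasing chains of sets *)

Section rank.
Context d (T : measurableType d) (R : realType) (P : probability T R).
Implicit Types (A B : (set T)^nat) (X Z : T -> R).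

Definition vanishing_chain A :=
  [/\ forall n, measurable (A n), forall n, A n.+1 `<=` A n & \bigcap_n A n = set0].

(** The number of sets of the chain that contain [x]; on a vanishing chain it is finite, so [fine]
    loses nothing. *)
Definition rank A (x : T) : R := fine (\sum_(k <oo) (\1_(A k) x)%:E).

(** A decreasing chain with empty intersection contains [x] exactly up to a first index [N] at which
    it leaves it, and the series counts the indices below [N]. *)
Lemma rank_spec A x : vanishing_chain A -> exists N : nat,
  [/\ forall k, A k x <-> (k < N)%N, rank A x = N%:R &
      \sum_(k <oo) (\1_(A k) x)%:E = (rank A x)%:E].
Proof.
move=> [_ AS A0].
have decr k m : (k <= m)%N -> A m x -> A k x.
  by move=> /subnK <-; elim: (m - k)%N => [//|j IH /AS].
have exN : exists n, `[< ~ A n x >].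
  apply: contrapT => nex; have : (\bigcap_n A n) x.
    by move=> n _; apply: contrapT => nA; apply: nex; exists n; exact/asboolP.
  by rewrite A0.
have AN k : A k x <-> (k < ex_minn exN)%N.
  case: ex_minnP => N /asboolP nAN minN; split=> [Akx|kN].
    by rewrite ltnNge; apply/negP => Nk; apply: nAN; exact: decr Nk _.
  by apply: contrapT => /asboolP /minN; rewrite leqNgt kN.
exists (ex_minn exN).
suff sE : \sum_(k <oo) (\1_(A k) x)%:E = (ex_minn exN)%:R%:E :> \bar R.
  by split=> //; rewrite /rank sE.
rewrite (nneseries_split _ (ex_minn exN)); last by move=> k _; rewrite lee_fin.
rewrite add0n eseries0 ?adde0; last first.
  move=> k Nk _; rewrite indicE memNset// => /AN; by rewrite ltnNge Nk.
rewrite (eq_big_nat _ _ (F2 := fun=> 1%E)); last first.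
  by move=> k kN; rewrite indicE mem_set//; apply/AN.
by rewrite big_mkord sumEFin sumr_const card_ord.
Qed.

Lemma measurable_rank A : vanishing_chain A -> measurable_fun setT (rank A).
Proof.
move=> [mA _ _]; apply: measurableT_comp => //.
apply: ge0_emeasurable_sum => [k x _ _|k _]; first by rewrite lee_fin.
by apply/measurable_EFinP; exact: measurable_indic.
Qed.

Lemma integral_rank A Z : vanishing_chain A -> measurable_fun setT Z ->
  (forall x, 0 <= Z x)%R ->
  \int[P]_x (Z x * rank A x)%:E = \sum_(k <oo) \int[P]_(x in A k) (Z x)%:E.
Proof.
move=> cA mZ Z0; have [mA _ _] := cA.
transitivity (\int[P]_x \sum_(k <oo) (Z x * \1_(A k) x)%:E).
  apply: eq_integral => x _; have [N [_ _ sE]] := rank_spec x cA.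
  rewrite EFinM -sE -nneseriesZl//.
rewrite integral_nneseries//; last 2 first.
- move=> k; apply/measurable_EFinP/measurable_funM => //; exact: measurable_indic.
- by move=> k x _; rewrite lee_fin mulr_ge0.
apply: eq_eseriesr => k _; rewrite [RHS]integral_mkcond.
by apply: eq_integral => x _; rewrite epatch_indic EFinM.
Qed.

(** Open right half-lines are stable under intersection and generate the Borel sets. *)
Lemma same_law_gt X X' : rv X -> rv X' ->
  (forall t : R, P [set x | (t < X x)%R] = P [set x | (t < X' x)%R]) ->
  same_law P X X'.
Proof.
move=> mX mX' XX' S mS.
pose X1 : {mfun T >-> R} :=
  HB.pack X (isMeasurableFun.Build _ _ _ _ X mX).
pose X2 : {mfun T >-> R} :=
  HB.pack X' (isMeasurableFun.Build _ _ _ _ X' mX').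
apply: (@measure_unique _ R R (@RGenOInfty.G R)
  (fun k => `](- k%:R)%R, +oo[%classic) _ _ _ _
  (distribution P X1) (distribution P X2)) => //.
- exact: RGenOInfty.measurableE.
- move=> _ _ [s ->] [t ->]; exists (Num.max s t).
  by apply/seteqP; split=> r /=; rewrite !in_itv/= !andbT gt_max;
    [move=> [-> ->]|move=> /andP].
- by move=> k; exists (- k%:R)%R.
- apply/seteqP; split=> // r _; exists (Num.truncn (- r)).+1 => //=.
  by rewrite in_itv/= andbT ltrNl truncnS_gt.
- by move=> _ [t ->]; have := XX' t; rewrite -!preimage_itvoy.
- move=> k; apply: (le_lt_trans _ (ltry 1)).
  exact: (probability_le1 (distribution P X1) (measurable_itv _)).
Qed.

(** The index [n] depends on [e] and [t] only, so the same member of any pair of chains describes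
    the event; this lets equal probabilities along chains yield equal laws. Disjoint first sets
    ensure that at most one rank is nonzero at a point. *)
Lemma rank_diff_gt (e t : R) : (0 < e)%R -> exists n : nat,
  (forall A B, vanishing_chain A -> vanishing_chain B -> A 0%N `&` B 0%N = set0 ->
    [set x | (t < e * (rank A x - rank B x))%R] = A n) \/
  (forall A B, vanishing_chain A -> vanishing_chain B -> A 0%N `&` B 0%N = set0 ->
    [set x | (t < e * (rank A x - rank B x))%R] = ~` B n).
Proof.
move=> e0.
have disj A B x N M : A 0%N `&` B 0%N = set0 ->
    (forall k, A k x <-> (k < N)%N) -> (forall k, B k x <-> (k < M)%N) ->
    N = 0%N \/ M = 0%N.
  move=> AB AN BM; case: N AN => [|N] AN; first by left.
  case: M BM => [|M] BM; first by right.
  suff : (A 0%N `&` B 0%N) x by rewrite AB.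
  by split; [exact/AN|exact/BM].
have [t0|t0] := leP 0%R t.
  (* For [t >= 0], [t < e * N] means that the integer part of [t / e] is below [N]. *)
  exists (Num.truncn (t / e)); left=> A B cA cB AB; apply/seteqP.
  have /truncn_itv/andP[le_n lt_n] : (0 <= t / e)%R by rewrite divr_ge0// ltW.
  suff H x : (t < e * (rank A x - rank B x))%R <-> A (Num.truncn (t / e)) x.
    by split=> x /H.
  have [N [AN -> _]] := rank_spec x cA; have [M [BM -> _]] := rank_spec x cB.
  rewrite mulrC -ltr_pdivrMr// AN; have [->|->] := disj _ _ _ _ _ AB AN BM.
    rewrite sub0r ltn0; split=> // h.
    have : (0 < - M%:R :> R)%R by rewrite (le_lt_trans _ h)// divr_ge0// ltW.
    by rewrite oppr_gt0 ltrn0.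
  rewrite subr0; split=> h.
    by rewrite -(ltr_nat R) (le_lt_trans le_n).
  by rewrite (lt_le_trans lt_n)// ler_nat.
have s0 : (0 < - t / e)%R by rewrite divr_gt0// oppr_gt0.
(* [n + 1] is the ceiling of [- t / e], so that [- (e * M) <= t] means [n < M]. *)
have [n lt_n le_n] : exists2 n : nat, (n%:R < - t / e)%R & (- t / e <= n.+1%:R)%R.
  have /truncn_itv/andP[le_n lt_n] := ltW s0.
  case: (Num.truncn (- t / e)) (le_n) (lt_n) => [|n] h1 h2.
    by exists 0%N => //; exact: ltW.
  have [h|h] := ltP n.+1%:R%R (- t / e)%R; first by exists n.+1 => //; exact: ltW.
  by exists n => //; rewrite (lt_le_trans _ h1)// ltr_nat.
exists n; right=> A B cA cB AB; apply/seteqP.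
suff H x : (e * (rank A x - rank B x) <= t)%R <-> B n x.
  split=> x /=; first by move=> h /H; rewrite leNgt h.
  by move=> h; rewrite ltNge; apply/negP => /H.
have [N [AN -> _]] := rank_spec x cA; have [M [BM -> _]] := rank_spec x cB.
rewrite -[X in (X <= _)%R]opprK lerNl -mulrN opprB mulrC -ler_pdivrMr// BM.
have [->|->] := disj _ _ _ _ _ AB AN BM.
  rewrite subr0; split=> h; first by rewrite -(ltr_nat R) (lt_le_trans lt_n).
  by rewrite (le_trans le_n)// ler_nat.
rewrite sub0r ltn0; split=> // h.
have : (0 < - N%:R :> R)%R by exact: lt_le_trans h.
by rewrite oppr_gt0 ltrn0.
Qed.

Lemma measurable_rank_diff A B (e : R) : vanishing_chain A -> vanishing_chain B ->
  rv (fun x => e * (rank A x - rank B x))%R.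
Proof.
move=> cA cB; apply: measurable_funM => //.
by apply: measurable_funB; exact: measurable_rank.
Qed.

Lemma rank_diff_same_law A B A' B' (e : R) : (0 < e)%R ->
  vanishing_chain A -> vanishing_chain B -> A 0%N `&` B 0%N = set0 ->
  vanishing_chain A' -> vanishing_chain B' -> A' 0%N `&` B' 0%N = set0 ->
  (forall n, P (A n) = P (A' n)) -> (forall n, P (B n) = P (B' n)) ->
  same_law P (fun x => e * (rank A x - rank B x))%R
             (fun x => e * (rank A' x - rank B' x))%R.
Proof.
move=> e0 cA cB AB cA' cB' AB' PA PB.
apply: same_law_gt => [||t]; [exact: measurable_rank_diff..|].
have [mB _ _] := cB; have [mB' _ _] := cB'.
have [n [H|H]] := rank_diff_gt t e0; rewrite !H//.
by rewrite !probability_setC// PB.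
Qed.

Lemma rank_diff_pos A B (e : R) x : (0 < e)%R -> vanishing_chain A ->
  vanishing_chain B -> A 0%N `&` B 0%N = set0 ->
  Num.max (e * (rank A x - rank B x))%R 0%R = (e * rank A x)%R /\
  Num.max (- (e * (rank A x - rank B x)))%R 0%R = (e * rank B x)%R.
Proof.
move=> e0 cA cB AB.
have [N [AN -> _]] := rank_spec x cA; have [M [BM -> _]] := rank_spec x cB.
have e1 k : (0 <= e * k%:R)%R by rewrite mulr_ge0// ltW.
have [->|M0] := posnP M.
  by rewrite subr0 mulr0 max_l// max_r// oppr_le0.
have [->|N0] := posnP N.
  by rewrite sub0r mulr0 mulrN opprK max_r ?oppr_le0// max_l.
suff : (A 0%N `&` B 0%N) x by rewrite AB.
by split; [exact/AN|exact/BM].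
Qed.

(** The rank is the ceiling of the positive part of [X / e]. *)
Lemma rank_gt_bounds X (e : R) x : (0 < e)%R ->
  vanishing_chain (fun n => [set x | (e * n%:R < X x)%R]) ->
  (Num.max (X x) 0 <= e * rank (fun n => [set x | (e * n%:R < X x)%R]) x
                   <= Num.max (X x) 0 + e)%R.
Proof.
move=> e0 cA; have [N [/= AN -> _]] := rank_spec x cA; apply/andP; split.
  rewrite ge_max (mulr_ge0 (ltW e0) (ler0n _ _)) andbT leNgt; apply/negP => /AN.
  by rewrite ltnn.
case: N AN => [|N] AN; first by rewrite mulr0 addr_ge0 ?(ltW e0)// le_max lexx orbT.
have /(_ (ltnSn N)) h := (AN N).2.
by rewrite -natr1 mulrDr mulr1 lerD2r le_max (ltW h).
Qed.

(** The rank is the floor of the negative part of [X / e]: rounding [X] up rounds its negative part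
    down. *)
Lemma rank_le_bounds X (e : R) x : (0 < e)%R ->
  vanishing_chain (fun n => [set x | (X x <= - (e * n.+1%:R))%R]) ->
  (e * rank (fun n => [set x | (X x <= - (e * n.+1%:R))%R]) x <= Num.max (- X x) 0
   <= e * rank (fun n => [set x | (X x <= - (e * n.+1%:R))%R]) x + e)%R.
Proof.
move=> e0 cB; have [N [/= BN -> _]] := rank_spec x cB; apply/andP; split.
  case: N BN => [|N] BN; first by rewrite mulr0 le_max lexx orbT.
  by have /(_ (ltnSn N)) h := (BN N).2; rewrite le_max lerNr h.
rewrite ge_max (addr_ge0 (mulr_ge0 (ltW e0) (ler0n _ _)) (ltW e0)) andbT.
have : ~ (X x <= - (e * N.+1%:R))%R by move=> /BN; rewrite ltnn.
by move=> /negP; rewrite -ltNge ltrNl -natr1 mulrDr mulr1 => /ltW.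
Qed.

End rank.

(** * Expectations under a density, with the convention for infinite values *)

Section expQ_theory.
Context d (T : measurableType d) (R : realType) (P : probability T R).
Implicit Types (X Z V : T -> R).

Lemma density_integrable Z : density P Z -> P.-integrable setT (EFin \o Z).
Proof.
move=> [mZ Z0 Z1]; apply/integrableP; split; first exact/measurable_EFinP.
under eq_integral do rewrite /= ger0_norm//.
by rewrite Z1 ltry.
Qed.

Lemma measurable_mul_pos Z X : measurable_fun setT Z -> rv X ->
  measurable_fun setT (fun x => (Z x * Num.max (X x) 0)%:E).
Proof.
move=> mZ mX; apply/measurable_EFinP/measurable_funM => //.
exact: measurable_maxr.
Qed.

(** The default [-oo] is harmless on the left, and it cannot occur on the right alone, since [b']
    infinite forces [b] infinite. Otherwise the errors of the two parts add up. *)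
Let le_expected_shift (a b a' b' : \bar R) (e : R) : 0 <= b' ->
  a <= a' + e%:E -> b' <= b + e%:E ->
  (if b == +oo then -oo else a - b) <=
  (if b' == +oo then -oo else a' - b') + (e + e)%:E.
Proof.
move=> b'0 aa' bb'; case: ifPn => [_|bny]; first by rewrite leNye.
case: ifPn => [/eqP b'y|b'ny].
  by move: bb' bny; rewrite b'y; case: b => [r||].
have : b' \is a fin_num by rewrite ge0_fin_numE// lt_neqAle b'ny leey.
move: bb' aa' bny {b'ny b'0}; case: b' => // r'; case: b => //= r.
case: a' => [s'||]; case: a => [s||] //=;
  rewrite -?EFinB -?EFinD ?lee_fin ?leey ?leNye//; lra.
Qed.

Lemma le_expQ_shift Z V X X' (e : R) :
  0 <= \int[P]_x (V x * Num.max (- X' x) 0)%:E ->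
  \int[P]_x (Z x * Num.max (X x) 0)%:E <=
    \int[P]_x (V x * Num.max (X' x) 0)%:E + e%:E ->
  \int[P]_x (V x * Num.max (- X' x) 0)%:E <=
    \int[P]_x (Z x * Num.max (- X x) 0)%:E + e%:E ->
  expQ P Z X <= expQ P V X' + (e + e)%:E.
Proof. exact: le_expected_shift. Qed.

Lemma le_expQ Z X X' : density P Z -> rv X -> rv X' -> (forall x, X x <= X' x)%R ->
  expQ P Z X <= expQ P Z X'.
Proof.
move=> [mZ Z0 _] mX mX' XX'.
(* Monotonicity is the shift comparison with zero error in both parts. *)
suff : expQ P Z X <= expQ P Z X' + (0 + 0)%:E by rewrite addr0 adde0.
have mp (Y : T -> R) := @measurable_mul_pos Z Y mZ.
have mN (Y : T -> R) : rv Y -> rv (fun x => - Y x)%R.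
  by move=> mY; exact: measurableT_comp.
have pos Y x : 0 <= (Z x * Num.max (Y x) 0)%:E.
  by rewrite lee_fin mulr_ge0// le_max lexx orbT.
apply: le_expQ_shift; rewrite ?adde0.
- by apply: integral_ge0 => x _; exact: (pos (fun x => - X' x)%R).
- apply: ge0_le_integral; [by []|by move=> x _; exact: pos|exact: mp..|move=> x _].
  by rewrite lee_fin ler_wpM2l// ge_max !le_max XX' lexx orbT.
- apply: ge0_le_integral; [by []|move=> x _|exact: mp _ (mN _ mX')|exact: mp _ (mN _ mX)|].
    exact: (pos (fun x => - X' x)%R).
  by move=> x _; rewrite lee_fin ler_wpM2l// ge_max !le_max lerN2 XX' lexx orbT.
Qed.

Lemma eq_ae_expQ Z V X : measurable_fun setT Z -> measurable_fun setT V -> rv X ->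
  (\forall x \ae P, Z x = V x) -> expQ P Z X = expQ P V X.
Proof.
move=> mZ mV mX ZV; rewrite /expQ.
have E (Y : T -> R) : rv Y -> \int[P]_x (Z x * Num.max (Y x) 0)%:E =
    \int[P]_x (V x * Num.max (Y x) 0)%:E.
  move=> mY; apply: ae_eq_integral => //; [exact: measurable_mul_pos..|].
  by apply: filterS ZV => x -> _.
by rewrite E// (E (fun x => - X x)%R)//; exact: measurableT_comp.
Qed.

Lemma coherent_utility_le u X X' : coherent_utility P u -> rv X -> rv X' ->
  (forall x, X x <= X' x)%R -> u X <= u X'.
Proof.
move=> [D [_ Dd uE]] mX mX' XX'; rewrite !uE//.
apply: le_ereal_inf_tmp => _ [Z DZ <-].
by apply: (@le_trans _ _ (expQ P Z X)); [apply: ereal_inf_lbound; exists Z|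
  apply: le_expQ => //; exact: Dd].
Qed.

End expQ_theory.

(** * Stability of the determining set under conditioning *)

Section conditioning.
Context d (T : measurableType d) (R : realType) (P : probability T R).
Implicit Types (X Z V W : T -> R) (A B : (set T)^nat) (E : set T).

Lemma vanishing_chain_cvg0 A : vanishing_chain A -> P (A n) @[n --> \oo] --> 0.
Proof.
move=> [mA AS A0]; rewrite -(measure0 P) -A0; apply: nonincreasing_cvg_mu => //.
- exact: (le_lt_trans (probability_le1 P (mA 0%N)) (ltry _)).
- exact: bigcapT_measurable.
- move=> n m; elim: m => [|m IH]; first by rewrite leqn0 => /eqP ->.
  rewrite leq_eqVlt => /predU1P[->//|/IH/subsetPset nm].
  by apply/subsetPset; exact: subset_trans (AS m) nm.
Qed.

(** Lower sets with the probabilities of the [A n] are cut out of [E], and [lower_set_integral_le]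
    compares the integrals. Confinement to [E] later keeps two rearranged chains disjoint. *)
Lemma lower_rearrangement Z V A E : atomless P ->
  P.-integrable setT (EFin \o Z) -> P.-integrable setT (EFin \o V) ->
  (forall S, measurable S ->
    \int[P]_(x in V @^-1` S) (V x)%:E = \int[P]_(x in V @^-1` S) (Z x)%:E) ->
  measurable E -> lower_set_of Z E -> vanishing_chain A -> P (A 0%N) <= P E ->
  exists A', [/\ vanishing_chain A', A' 0%N `<=` E,
    forall n, P (A' n) = P (A n) &
    forall n, \int[P]_(x in A' n) (Z x)%:E <= \int[P]_(x in A n) (V x)%:E].
Proof.
move=> Pa intZ intV VZ mE lE cA PAE; have [mA AS A0] := cA.
have mZ : measurable_fun setT Z by apply/measurable_EFinP; exact: measurable_int intZ.
have PA n : P (A n) = (fine (P (A n)))%:E by rewrite fineK// fin_num_measure.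
have [C [mC CE CS lC PC]] := @lower_chain_measure _ _ _ _ Pa Z E
  (fun n => fine (P (A n))) mZ mE lE (fun n => fine_ge0 (measure_ge0 P (A n)))
  ltac:(by move=> n; rewrite -lee_fin -!PA; apply: le_measure; rewrite ?inE)
  ltac:(by rewrite -PA).
have {}PC n : P (C n) = P (A n) by rewrite PC -PA.
(* The new sets may have a common part, but it is null because [P (A n)] tends to [0]; removing it
   gives a vanishing chain and changes no probability or integral. *)
pose N := \bigcap_n C n.
have mN : measurable N by exact: bigcapT_measurable.
have PN : P N = 0.
  have NC n : P N <= P (A n).
    by rewrite -PC; apply: le_measure; rewrite ?inE// => x; exact.
  apply/eqP; rewrite eq_le measure_ge0 andbT.
  have cvA := vanishing_chain_cvg0 cA.
  rewrite -(cvg_lim _ cvA)//; apply: lime_ge; first by apply/cvg_ex; exists 0.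
  exact: nearW.
have mD n : measurable (C n `\` N) by exact: measurableD.
have PD n : P (C n `\` N) = P (A n).
  transitivity (P (C n) - P N); last by rewrite PN sube0.
  rewrite measureD//; first by rewrite setIidr// => x; exact.
  exact: (le_lt_trans (probability_le1 P (mC n)) (ltry _)).
exists (fun n => C n `\` N); split=> //.
- split=> // [n x [/CS Cx Nx]|]; first by split.
  by rewrite -subset0 => x h; have [_] := h 0%N I; apply=> n _; have [] := h n I.
- by move=> x [/CE].
- move=> n; rewrite -(@negligible_integral _ _ _ P)//; last exact: integrableS intZ.
  exact: (@lower_set_integral_le _ _ _ P Z V).
Qed.

Lemma integralN_EFin_integrable Z E : P.-integrable setT (EFin \o Z) ->
  measurable E -> \int[P]_(x in E) (- Z x)%:E = - \int[P]_(x in E) (Z x)%:E.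
Proof.
move=> intZ mE; have intN : P.-integrable setT (EFin \o (fun x => - Z x)%R).
  by have := integrableN intZ.
rewrite !EFin_Rintegral// -EFinN; congr EFin.
rewrite -mulN1r -RintegralZl//; last exact: integrableS intZ.
by apply: eq_Rintegral => x _; rewrite mulN1r.
Qed.

Lemma integral_scaled_rank A Z (e : R) : (0 <= e)%R -> vanishing_chain A ->
  measurable_fun setT Z -> (forall x, 0 <= Z x)%R ->
  \int[P]_x (Z x * (e * rank R A x))%:E =
  e%:E * \sum_(k <oo) \int[P]_(x in A k) (Z x)%:E.
Proof.
move=> e0 cA mZ Z0; rewrite -integral_rank// -ge0_integralZl_EFin//.
- by apply: eq_integral => x _; rewrite -EFinM mulrCA.
- move=> x _; have [N [_ -> _]] := rank_spec R x cA.
  by rewrite lee_fin mulr_ge0.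
- by apply/measurable_EFinP/measurable_funM => //; exact: measurable_rank.
Qed.

Lemma integral_density_addr V X (e : R) : (0 <= e)%R -> density P V -> rv X ->
  (forall x, 0 <= X x)%R ->
  \int[P]_x (V x * (X x + e))%:E = \int[P]_x (V x * X x)%:E + e%:E.
Proof.
move=> e0 [mV V0 V1] mX X0.
have -> : e%:E = \int[P]_x (V x * e)%:E.
  under eq_integral do rewrite mulrC EFinM.
  rewrite ge0_integralZl_EFin// ?V1 ?mule1//; last exact/measurable_EFinP.
  by move=> x _; rewrite lee_fin.
rewrite -ge0_integralD//.
- by apply: eq_integral => x _; rewrite mulrDr EFinD.
- by move=> x _; rewrite lee_fin mulr_ge0.
- exact/measurable_EFinP/measurable_funM.
- by move=> x _; rewrite lee_fin mulr_ge0.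
- exact/measurable_EFinP/measurable_funM.
Qed.

Lemma vanishing_chain_gt X (e : R) : rv X -> (0 < e)%R ->
  vanishing_chain (fun n => [set x | (e * n%:R < X x)%R]).
Proof.
move=> mX e0; split=> [n|n x /=|].
- rewrite -preimage_itvoy -[X in measurable X]setTI; exact: mX.
- by apply: le_lt_trans; rewrite ler_pM2l// ler_nat.
- rewrite -subset0 => x /(_ (Num.truncn (X x / e)).+1 I)/=.
  by rewrite mulrC ltNge -ler_pdivrMr// ltW// truncnS_gt.
Qed.

Lemma vanishing_chain_le X (e : R) : rv X -> (0 < e)%R ->
  vanishing_chain (fun n => [set x | (X x <= - (e * n.+1%:R))%R]).
Proof.
move=> mX e0; split=> [n|n x /=|].
- rewrite -preimage_itvNyc -[X in measurable X]setTI; exact: mX.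
- by move/le_trans; apply; rewrite lerN2 ler_pM2l// ler_nat.
- rewrite -subset0 => x /(_ (Num.truncn (- X x / e)) I)/=.
  by rewrite lerNr leNgt mulrC -ltr_pdivrMr// truncnS_gt.
Qed.

(** The integral identity says that [V] is the conditional expectation of [Z] given [V] itself, a
    property shared by all conditional expectations of [Z]. *)
Lemma determining_set_conditioning (u : (T -> R) -> \bar R) Z V :
  atomless P -> coherent_utility P u -> law_invariant P u ->
  determining_set P u Z -> density P V ->
  (forall S, measurable S ->
    \int[P]_(x in V @^-1` S) (V x)%:E = \int[P]_(x in V @^-1` S) (Z x)%:E) ->
  determining_set P u V.
Proof.
move=> Pa cu lu [dZ uZ] dV VZ; split=> // X mX; apply/lee_addgt0Pr => e2 e20.
(* Rounding costs [e] in the positive part and [e] in the negative part. *)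
pose e := (e2 / 2)%R; have e0 : (0 < e)%R by rewrite divr_gt0.
have e0' := ltW e0.
have -> : e2 = (e + e)%R by rewrite /e -splitr.
(* The strict inequality in [A] and the shifted index in [B] make [e * (rank A - rank B)] the least
   multiple of [e] that is at least [X]. *)
pose A n := [set x | (e * n%:R < X x)%R].
pose B n := [set x | (X x <= - (e * n.+1%:R))%R].
have cA : vanishing_chain A by exact: vanishing_chain_gt.
have cB : vanishing_chain B by exact: vanishing_chain_le.
have AB : A 0%N `&` B 0%N = set0.
  by rewrite -subset0 => x []; rewrite /A /B/= mulr0 mulr1 => x0 xe; lra.
have [mA _ _] := cA; have [mB _ _] := cB.
have intZ := density_integrable dZ; have intV := density_integrable dV.
have [mZ Z0 _] := dZ; have [mV V0 _] := dV.
have PA0 : P (A 0%N) = (fine (P (A 0%N)))%:E by rewrite fineK// fin_num_measure.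
(* [E] collects low values of [Z] and has just the probability of [A 0]. The new positive layers go
   inside [E] and the new negative ones outside, hence they stay disjoint. *)
have [E [mE _ lE PE]] := @lower_subset_measure _ _ _ P Pa Z setT
  (fine (P (A 0%N))) mZ measurableT (fun x y _ => False_ind _ \o (@^~ I))
  (fine_ge0 (measure_ge0 P _))
  ltac:(by rewrite -PA0 probability_setT probability_le1).
rewrite -PA0 in PE.
have [A' [cA' A'E PA' ZA']] := lower_rearrangement Pa intZ intV VZ mE lE cA
  ltac:(by rewrite PE).
(* For the negative layers large values of [Z] are wanted: the same rearrangement is applied to
   [- Z] and [- V] on the complement of [E], a lower set of [- Z]. *)
have lE' : lower_set_of (fun x => - Z x)%R (~` E).
  by move=> x y nEx /contrapT Ey; rewrite lerN2; exact: lE.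
have NVZ S : measurable S ->
    \int[P]_(x in (fun x => - V x)%R @^-1` S) (- V x)%:E =
    \int[P]_(x in (fun x => - V x)%R @^-1` S) (- Z x)%:E.
  move=> mS; have mNS : measurable (-%R @^-1` S : set R).
    by rewrite -[X in measurable X]setTI; exact: oppr_measurable.
  have mVS : measurable (V @^-1` (-%R @^-1` S)).
    by rewrite -[X in measurable X]setTI; exact: mV.
  by rewrite !integralN_EFin_integrable//; congr (- _); exact: (VZ _ mNS).
have PBE : P (B 0%N) <= P (~` E).
  rewrite probability_setC// PE -probability_setC//.
  apply: le_measure; rewrite ?inE//; first exact: measurableC.
  by move=> x Bx Ax; suff : (A 0%N `&` B 0%N) x by rewrite AB.
have [B' [cB' B'E PB' ZB']] := lower_rearrangement Pa (integrableN intZ)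
  (integrableN intV) NVZ (measurableC mE) lE' cB PBE.
have [mB' _ _] := cB'.
have {}ZB' n : \int[P]_(x in B n) (V x)%:E <= \int[P]_(x in B' n) (Z x)%:E.
  by rewrite -leeN2 -!integralN_EFin_integrable.
have AB' : A' 0%N `&` B' 0%N = set0.
  by rewrite -subset0 => x [/A'E Ex /B'E].
pose F x := (e * (rank R A x - rank R B x))%R.
pose F' x := (e * (rank R A' x - rank R B' x))%R.
have mF : rv F by exact: measurable_rank_diff.
have mF' : rv F' by exact: measurable_rank_diff.
have boundA x := @rank_gt_bounds _ _ _ X e x e0 cA.
have boundB x := @rank_le_bounds _ _ _ X e x e0 cB.
have XF x : (X x <= F x)%R.
  have /andP[hA _] := boundA x; have /andP[hB _] := boundB x.
  have XE : X x = (Num.max (X x) 0 - Num.max (- X x) 0)%R.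
    have /orP[x0|x0] := le_total 0%R (X x).
      by rewrite max_l// max_r ?oppr_le0// subr0.
    by rewrite max_r// max_l ?oppr_ge0// sub0r opprK.
  by rewrite XE /F mulrBr lerB.
have uXF : u X <= u F by exact: coherent_utility_le cu mX mF XF.
(* Law invariance enters here: [F] and [F'] are built alike from chains of equal probabilities. *)
have uFF' : u F = u F'.
  by apply: lu => //; apply: rank_diff_same_law => // n; rewrite ?PA' ?PB'.
rewrite (le_trans uXF)// uFF' (le_trans (uZ _ mF'))//.
have rank_ge0 C x : vanishing_chain C -> (0 <= rank R C x)%R.
  by move=> cC; have [N [_ -> _]] := rank_spec R x cC.
have pos_ge0 (r : R) : (0 <= Num.max r 0)%R by rewrite le_max lexx orbT.
have mNX : rv (fun x => - X x)%R by exact: measurableT_comp.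
have mpX : rv (fun x => Num.max (X x) 0)%R by exact: measurable_maxr.
have mrank C : vanishing_chain C -> rv (fun x => e * rank R C x)%R.
  by move=> cC; apply: measurable_funM => //; exact: measurable_rank.
(* Positive parts: [E_Z F'^+ <= E_V F^+ <= E_V X^+ + e]. Negative parts:
   [E_V X^- <= E_V F^- + e <= E_Z F'^- + e]. In each, one step is layerwise and the other is the
   rounding bound. *)
apply: le_expQ_shift.
- by apply: integral_ge0 => x _; rewrite lee_fin mulr_ge0.
- under eq_integral do rewrite (rank_diff_pos _ e0 cA' cB' AB').1.
  rewrite -integral_density_addr// integral_scaled_rank//.
  apply: (@le_trans _ _ (\int[P]_x (V x * (e * rank R A x))%:E)).
    rewrite integral_scaled_rank// lee_pmul2l//.
    apply: lee_nneseries => [n _ _|n _]; last exact: ZA'.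
    by apply: integral_ge0 => x _; rewrite lee_fin.
  apply: ge0_le_integral => //.
  + move=> x _; rewrite lee_fin; apply: mulr_ge0 => //; apply: mulr_ge0 => //.
    exact: rank_ge0.
  + by apply/measurable_EFinP/measurable_funM => //; exact: mrank.
  + by apply/measurable_EFinP/measurable_funM => //; exact: measurable_funD.
  + move=> x _; rewrite lee_fin ler_wpM2l//.
    by have /andP[] := boundA x.
- under [in leRHS]eq_integral do rewrite (rank_diff_pos _ e0 cA' cB' AB').2.
  apply: (@le_trans _ _ (\int[P]_x (V x * (e * rank R B x + e))%:E)).
    apply: ge0_le_integral => //.
    + by move=> x _; rewrite lee_fin mulr_ge0.
    + exact: measurable_mul_pos.
    + apply/measurable_EFinP/measurable_funM => //; apply: measurable_funD => //.
      exact: mrank.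
    + move=> x _; rewrite lee_fin ler_wpM2l//.
      by have /andP[] := boundB x.
  rewrite integral_density_addr//; last 2 first.
  + exact: mrank.
  + by move=> x; apply: mulr_ge0 => //; exact: rank_ge0.
  rewrite leeD2r// !integral_scaled_rank// lee_pmul2l//.
  apply: lee_nneseries => [n _ _|n _]; last exact: ZB'.
  by apply: integral_ge0 => x _; rewrite lee_fin.
Qed.

(* A version of the conditional expectation need only be nonnegative almost
   everywhere; its positive part is a version that is a genuine density. *)
Lemma is_condexp_pos (G : set (set T)) Z W : G `<=` measurable ->
  density P Z -> is_condexp P G Z W ->
  [/\ density P (fun x => Num.max (W x) 0)%R,
      is_condexp P G Z (fun x => Num.max (W x) 0)%R &
      \forall x \ae P, W x = Num.max (W x) 0%R].
Proof.
move=> GT dZ [GW intW WZ]; have [mZ Z0 Z1] := dZ.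
have GsetT : G setT by exact: (GW setT).
have mW : measurable_fun setT W.
  by apply/measurable_EFinP; exact: measurable_int intW.
pose V x := Num.max (W x) 0%R.
have mV : measurable_fun setT V by exact: measurable_maxr.
pose N := W @^-1` `]-oo, 0%R[.
have GN : G N by apply: GW; exact: measurable_itv.
have mN : measurable N by exact: GT.
have NP x : N x = (W x < 0)%R :> Prop by rewrite /N/= in_itv.
have WV : \forall x \ae P, W x = V x.
  (* Over the event [N] of [G], [W] has the same integral as [Z], which is nonnegative, although
     [W < 0] there; so the integral of [|W|] over [N] vanishes. *)
  have : \int[P]_(x in N) `|(W x)%:E| = 0.
    have -> : \int[P]_(x in N) `|(W x)%:E| = \int[P]_(x in N) (- W x)%:E.
      apply: eq_integral => x /set_mem; rewrite NP => /ltW W0.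
      by rewrite /= ler0_norm.
    apply/eqP; rewrite eq_le; apply/andP; split; last first.
      by apply: integral_ge0 => x; rewrite NP lee_fin oppr_ge0 => /ltW.
    rewrite integralN_EFin_integrable// WZ// leeNl oppe0.
    by apply: integral_ge0 => x _; rewrite lee_fin.
  have intNW := integrableS measurableT mN (@subsetT _ _) intW.
  move/(ae_eq_integral_abs _ mN (measurable_int _ intNW)).
  apply: filterS => x WN0; rewrite /V; case: leP => //.
  rewrite le_eqVlt => /predU1P[//|W0].
  by have Nx : N x by [rewrite NP]; have [] := WN0 Nx.
have intV : P.-integrable setT (EFin \o V).
  apply: (le_integrable measurableT _ _ intW); first exact/measurable_EFinP.
  move=> x _; rewrite /= lee_fin /V; case: (leP (W x) 0%R) => // _.
  by rewrite normr0 normr_ge0.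
have VE E : measurable E -> \int[P]_(x in E) (V x)%:E = \int[P]_(x in E) (W x)%:E.
  move=> mE; apply: ae_eq_integral => //.
  - by apply/measurable_EFinP; exact: measurable_funTS.
  - by apply/measurable_EFinP; exact: measurable_funTS.
  - by apply: filterS WV => x -> _.
split=> //.
- split=> //; first by move=> x; rewrite le_max lexx orbT.
  by rewrite VE// WZ.
- split=> // [S mS|E GE]; last by rewrite VE ?WZ//; exact: GT.
  have mmax : measurable_fun setT (fun r : R => Num.max r 0%R).
    exact: measurable_maxr.
  have mS' : measurable ((fun r : R => Num.max r 0%R) @^-1` S).
    by rewrite -[X in measurable X]setTI; exact: mmax.
  exact: (GW _ mS').
Qed.

Lemma sigmaY_measurable n (Y : 'I_n -> T -> R) : rvec Y ->
  sigmaY Y `<=` measurable.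
Proof.
move=> mY; apply: smallest_sub; first exact: sigma_algebra_measurable.
move=> _ [i [S [mS ->]]]; rewrite -[X in measurable X]setTI; exact: mY.
Qed.

Lemma sigmaY_vcat n m (Y : 'I_n -> T -> R) (Y' : 'I_m -> T -> R) :
  sigmaY Y `<=` sigmaY (vcat Y Y').
Proof.
apply: smallest_sub; first exact: smallest_sigma_algebra.
move=> A [i [S [mS AE]]]; apply: sub_sigma_algebra; exists (lshift m i), S.
by rewrite /vcat (unsplitK (inl i)).
Qed.

End conditioning.

Unset Implicit Arguments.

Theorem theorem3p7 (d : measure_display) (T : measurableType d) (R : realType)
  (P : probability T R) (u : (T -> R) -> \bar R) (D : set (T -> R)) :
  atomless P -> coherent_utility P u -> law_invariant P u ->
  D = determining_set P u ->
  forall (X : T -> R) (n m : nat) (Y : 'I_n -> T -> R) (Y' : 'I_m -> T -> R),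
    rv X -> rvec Y -> rvec Y' ->
    factor_utility P D (vcat Y Y') X <= factor_utility P D Y X.
Proof.
move=> Pa cu lu -> X n m Y Y' mX mY mY'.
apply: le_ereal_inf_tmp => _ [W [Z DZ cW] <-].
have [dZ _] := DZ; have [_ intW _] := cW.
have [dV cV WV] := is_condexp_pos (sigmaY_measurable mY) dZ cW.
have [mV _ _] := dV; have [GV intV VZ] := cV.
(* The preimages of Borel sets under the positive part of [W] lie in the sigma-algebra of [Y], so
   the required identity is an instance of [VZ]. *)
have DV := determining_set_conditioning Pa cu lu DZ dV (fun S mS => VZ _ (GV S mS)).
rewrite (eq_ae_expQ _ mV mX WV); last first.
  by apply/measurable_EFinP; exact: measurable_int intW.
(* The positive part of [W] serves both as the element of [D] and as its own conditional expectation
   given the compound vector. *)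
apply: ereal_inf_lbound; exists (fun x => Num.max (W x) 0%R) => //.
exists (fun x => Num.max (W x) 0%R) => //; split=> // S mS.
by apply: sigmaY_vcat; exact: GV.
Qed.
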